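(* In the $S_1S_0$ and $S_0S_0$ subgames (i.e. when $\varphi_1+\varphi_2\le1$), for any demand $D>0$, each supplier $i\in\{1,2\}$ always gets strictly positive revenue at (both pure and mixed) price equilibrium, i.e. $\pi_i^{RE}>0$.
   Context: There are two suppliers $i\in\{1,2\}$; $-i$ denotes the other supplier. Constants: demand $D>0$, price cap $\bar p>0$, penalty price $\lambda>\bar p$. Supplier $i$'s renewable generation is a random variable $X_i$ bounded in $[0,\bar X_i]$ with continuous CDF $F_i$ and density $f_i$; $F_i$ is invertible on $[0,\bar X_i]$, with inverse $F_i^{-1}$ and $F_i^{-1}(0)=0$. $\varphi_i=1$ means supplier $i$ invests in storage, $\varphi_i=0$ that he does not. Each supplier bids a price $p_i\in[0,\bar p]$; his bidding quantity is $y_i^*(p_i,\varphi_i)=\mathbb E[X_i]$ if $\varphi_i=1$ and $y_i^*(p_i,\varphi_i)=F_i^{-1}(p_i/\lambda)$ if $\varphi_i=0$; write $\boldsymbol y^*(\boldsymbol p)$ for the pair. Consumers' purchase: if $p_i<p_{-i}$, then $x_i^*(\boldsymbol p,\boldsymbol y)=\min(D,y_i)$ and $x_{-i}^*(\boldsymbol p,\boldsymbol y)=\min(D-\min(D,y_i),\,y_{-i})$. If $p_1=p_2$, the demand is allocated according to the rule for either $p_1<p_2$ or $p_2<p_1$, the choice being made so as to maximize the two suppliers' total revenue (with equal probabilities if there is no difference). Revenue, with $(g)^+=\max(g,0)$: $\pi_i^R(p_i,x,\boldsymbol\varphi)=p_ix-\lambda(x-\mathbb E[X_i])^+$ if $\varphi_i=1$,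 and $\pi_i^R(p_i,x,\boldsymbol\varphi)=p_ix-\lambda\mathbb E[(x-X_i)^+]$ if $\varphi_i=0$. Price equilibrium: a pair of prices (pure) or of independent probability measures on $[0,\bar p]$ (mixed) such that no supplier can increase his (expected) revenue $\pi_i^R(p_i,x_i^*(\boldsymbol p,\boldsymbol y^*(\boldsymbol p)),\boldsymbol\varphi)$ by a unilateral change of his price strategy. $\pi_i^{RE}$ is the (expected) revenue of supplier $i$ at the equilibrium: the pure price equilibrium when one exists (for these subgames, exactly when $D\ge\sum_iy_i^*(\bar p,\varphi_i)$, with both prices equal to $\bar p$), and a mixed price equilibrium otherwise. *)

(* Defs.v *)
From HB Require Import structures.
From mathcomp Require Export all_boot all_order all_algebra.
From mathcomp Require Export all_classical all_reals all_analysis.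

Set Implicit Arguments.
Unset Strict Implicit.
Unset Printing Implicit Defensive.

Export Order.TTheory GRing.Theory Num.Theory.
Export numFieldNormedType.Exports.

Global Open Scope classical_set_scope.
Global Open Scope ring_scope.

(* The two suppliers are indexed by [bool] ([false] is supplier 1, [true] is
   supplier 2), so that [~~ i] is the competitor of [i].  [cdf_inv i] is the
   inverse of the CDF of [gen i] between [0, capacity i] and [0, 1]; its values
   outside [0, 1] are irrelevant. *)
Record market d (T : measurableType d) (R : realType) := Market {
  demand : R;
  price_cap : R;
  penalty : R;
  Pr : probability T R;
  gen : bool -> {RV Pr >-> R};
  capacity : bool -> R;
  pdf : bool -> R -> R;
  cdf_inv : bool -> R -> R;
  genF := fun i x => fine (cdf (gen i) x);
  demand_gt0 : 0 < demand;
  price_cap_gt0 : 0 < price_cap;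
  price_cap_lt_penalty : price_cap < penalty;
  gen_bounded : forall i w, 0 <= gen i w <= capacity i;
  genF_continuous : forall i, continuous (genF i);
  pdf_ge0 : forall i x, 0 <= pdf i x;
  pdf_measurable : forall i, measurable_fun setT (pdf i);
  pdfP : forall i (A : set R), measurable A ->
    distribution Pr (gen i) A
    = (\int[lebesgue_measure]_(x in A) (pdf i x)%:E)%E;
  cdf_inv_range : forall i u, 0 <= u <= 1 -> 0 <= cdf_inv i u <= capacity i;
  cdf_invK : forall i u, 0 <= u <= 1 -> genF i (cdf_inv i u) = u;
  genFK : forall i x, 0 <= x <= capacity i -> cdf_inv i (genF i x) = x;
  cdf_inv0 : forall i, cdf_inv i 0 = 0
}.

Definition mean_gen d (T : measurableType d) (R : realType) (M : market T R)
    (i : bool) : R :=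
  fine 'E_(Pr M)[gen M i].

(* Throughout, [phi i] holds iff supplier [i] invests in storage. *)
Definition bid_quantity d (T : measurableType d) (R : realType)
    (M : market T R) (phi : bool -> bool) (p : bool -> R) (i : bool) : R :=
  if phi i then mean_gen M i else cdf_inv M i (p i / penalty M).

(* Quantity bought from [i] when [k] is served first. *)
Definition alloc (R : realType) (D : R) (y : bool -> R) (k i : bool) : R :=
  if i == k then Num.min D (y k)
  else Num.min (D - Num.min D (y k)) (y i).

Definition supplier_revenue d (T : measurableType d) (R : realType)
    (M : market T R) (phi : bool -> bool) (i : bool) (q x : R) : R :=
  if phi i then q * x - penalty M * Num.max (x - mean_gen M i) 0
  else q * x
       - penalty M * fine 'E_(Pr M)[fun w => Num.max (x - gen M i w) 0].

Definition revenue_first d (T : measurableType d) (R : realType)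
    (M : market T R) (phi : bool -> bool) (p : bool -> R) (k i : bool) : R :=
  supplier_revenue M phi i (p i)
    (alloc (demand M) (bid_quantity M phi p) k i).

Definition total_revenue_first d (T : measurableType d) (R : realType)
    (M : market T R) (phi : bool -> bool) (p : bool -> R) (k : bool) : R :=
  \sum_(i : bool) revenue_first M phi p k i.

(* Probability that [k] is served first: the lower price has priority; at equal
   prices the order with the larger total revenue is chosen, and each order has
   probability 1/2 if the two totals agree. *)
Definition first_prob d (T : measurableType d) (R : realType)
    (M : market T R) (phi : bool -> bool) (p : bool -> R) (k : bool) : R :=
  if p k < p (~~ k) then 1
  else if p (~~ k) < p k then 0
  else if total_revenue_first M phi p (~~ k) < total_revenue_first M phi p k
  then 1
  else if total_revenue_first M phi p k < total_revenue_first M phi p (~~ k)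
  then 0
  else 2^-1.

Definition revenue d (T : measurableType d) (R : realType)
    (M : market T R) (phi : bool -> bool) (p : bool -> R) (i : bool) : R :=
  \sum_(k : bool) first_prob M phi p k * revenue_first M phi p k i.

Definition deviate (S : Type) (s : bool -> S) (i : bool) (s' : S) : bool -> S :=
  fun j => if j == i then s' else s j.

Definition prices d (T : measurableType d) (R : realType) (M : market T R) :
    set R :=
  `[0, price_cap M].

Definition pure_equilibrium d (T : measurableType d) (R : realType)
    (M : market T R) (phi : bool -> bool) (p : bool -> R) : Prop :=
  (forall i, prices M (p i)) /\
  (forall i q, prices M q ->
     revenue M phi (deviate p i q) i <= revenue M phi p i).

(* Independent prices drawn from [mu false] and [mu true].  The integrand is
   only meaningful for admissible prices, hence the domain of integration, which
   has full measure for the mixed strategies below. *)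
Definition expected_revenue d (T : measurableType d) (R : realType)
    (M : market T R) (phi : bool -> bool)
    (mu : bool -> probability (measurableTypeR R) R) (i : bool) : \bar R :=
  (\int[mu false \x mu true]_(z in prices M `*` prices M)
     (revenue M phi (fun j => if j then z.2 else z.1) i)%:E)%E.

Definition mixed_strategy d (T : measurableType d) (R : realType)
    (M : market T R) (nu : probability (measurableTypeR R) R) : Prop :=
  nu (prices M) = 1%E.

Definition mixed_equilibrium d (T : measurableType d) (R : realType)
    (M : market T R) (phi : bool -> bool)
    (mu : bool -> probability (measurableTypeR R) R) : Prop :=
  (forall i, mixed_strategy M (mu i)) /\
  (forall i nu, mixed_strategy M nu ->
     (expected_revenue M phi (deviate mu i nu) i
      <= expected_revenue M phi mu i)%E).

(* Main.v *)
(* Facing a competitor without storage, a supplier who bids a small enough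
   price [q] is never shut out: a cheaper competitor offers at most
   [F^-1(q / lambda) <= D / 2].  This guarantees him a revenue bounded away
   from 0 whatever the competitor bids.  Facing a competitor with storage, one
   uses that this competitor in turn faces a supplier without storage and hence
   has a positive equilibrium revenue; as his revenue is at most [D] times his
   own price, he must bid above some [q > 0] with positive probability, and
   undercutting him at [q] is profitable. *)

Require Import Defs.
From mathcomp Require Import measurable_realfun lra.

Set Implicit Arguments.
Unset Strict Implicit.
Unset Printing Implicit Defensive.

(* No measurability is assumed: the integral of a nonnegative function is the
   supremum of the integrals of the simple functions below it. *)
Lemma ge0_le_integral_nonmeasurable d (T : measurableType d) (R : realType)
    (mu : {measure set T -> \bar R}) (D : set T) (f g : T -> \bar R) :
  (forall x, D x -> (0 <= f x)%E) -> (forall x, D x -> (f x <= g x)%E) ->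
  (\int[mu]_(x in D) f x <= \int[mu]_(x in D) g x)%E.
Proof.
move=> f0 fg.
rewrite !ge0_integralE//; last first.
  by move=> x Dx; exact: le_trans (f0 _ Dx) (fg _ Dx).
apply: le_ereal_sup => _ [h hf <-]; exists h => // x.
by apply: le_trans (hf x) _; exact: lee_restrict.
Qed.

Lemma neq_negb (i j : bool) : i != j -> j = ~~ i.
Proof. by case: i j => -[]. Qed.

(** * Distribution of the generation: CDF, its inverse, mean and expected shortfall *)

Section generation.
Context d (T : measurableType d) (R : realType) (M : market T R).
Implicit Types (i : bool) (x y z u : R).

Lemma genF_ge0 i x : 0 <= genF M i x.
Proof. exact/fine_ge0/cdf_ge0. Qed.

Lemma genF_le i x y : x <= y -> genF M i x <= genF M i y.
Proof.
move=> xy; rewrite /genF fine_le ?fin_num_measure//.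
by apply: cdf_nondecreasing.
Qed.

Lemma genFE i x : (genF M i x)%:E = Pr M (gen M i @^-1` `]-oo, x]).
Proof. by rewrite /genF fineK ?fin_num_measure. Qed.

(* [x - X] is at most [x - z] when [z < X <= x] and at most
   [x] when [X <= z]. *)
Lemma excess_le i x z : 0 <= z <= x ->
  fine 'E_(Pr M)[fun w => Num.max (x - gen M i w) 0]
  <= (x - z) * genF M i x + z * genF M i z.
Proof.
move=> /andP[z0 zx].
pose A t := gen M i @^-1` `]-oo, t].
have mA t : measurable (A t).
  by rewrite -[A t]setTI; exact: measurable_funP.
have E_le : ('E_(Pr M)[(fun w => Num.max (x - gen M i w) 0)%R]
    <= ((x - z) * genF M i x + z * genF M i z)%R%:E)%E.
  rewrite unlock; apply: le_trans.
    apply: (@ge0_le_integral_nonmeasurable _ _ _ _ _ _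
      (fun w => (x - z)%:E * (\1_(A x) w)%:E + z%:E * (\1_(A z) w)%:E)%E).
      by move=> w _ /=; rewrite lee_fin le_max lexx orbT.
    move=> w _ /=; rewrite -!EFinM -EFinD lee_fin !indicE.
    have /andP[X0 _] := gen_bounded M i w.
    have mem t : (w \in A t) = (gen M i w <= t).
      by apply/idP/idP => h; move: h; rewrite inE /A /= in_itv.
    rewrite !mem; case: (leP (gen M i w) x); case: (leP (gen M i w) z);
      move=> *; rewrite ge_max /=; apply/andP; split; nra.
  rewrite ge0_integralD//=; last 4 first.
  - by move=> w _; rewrite -EFinM lee_fin mulr_ge0// subr_ge0.
  - by apply: measurable_funeM; exact/measurable_EFinP/measurable_indic.
  - by move=> w _; rewrite -EFinM lee_fin mulr_ge0.
  - by apply: measurable_funeM; exact/measurable_EFinP/measurable_indic.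
  rewrite !ge0_integralZl//=; try by [rewrite lee_fin ?subr_ge0
    | exact/measurable_EFinP/measurable_indic
    | move=> w _; rewrite lee_fin].
  by rewrite !integral_indic// !setIT [leRHS]EFinD !EFinM !genFE.
rewrite -[leRHS]/(fine _%:E) fine_le//.
rewrite ge0_fin_numE ?(le_lt_trans E_le) ?ltry//.
by apply: expectation_ge0 => w; rewrite le_max lexx orbT.
Qed.

Lemma genF0 i : genF M i 0 = 0.
Proof. by rewrite -{1}(cdf_inv0 M i) cdf_invK// lexx ler01. Qed.

Lemma genF_inj i x y : 0 <= x <= capacity M i -> 0 <= y <= capacity M i ->
  genF M i x = genF M i y -> x = y.
Proof. by move=> hx hy xy; rewrite -(genFK hx) xy genFK. Qed.

(** The CDF is nondecreasing, and its left inverse [cdf_inv] makes it injective on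
    [[0, capacity M i]]; together these give strictness. *)
Lemma genF_lt i x y : 0 <= x -> x < y -> y <= capacity M i ->
  genF M i x < genF M i y.
Proof.
move=> x0 xy yc; rewrite lt_neqAle genF_le ?ltW// andbT.
apply/eqP => /genF_inj E; have : x != y by rewrite lt_eqF.
by rewrite E ?eqxx ?x0 ?yc ?(le_trans x0 (ltW xy)) ?(le_trans (ltW xy) yc).
Qed.

Lemma cdf_inv_gt0 i u : 0 < u -> u <= 1 -> 0 < cdf_inv M i u.
Proof.
move=> u0 u1; have u01 : 0 <= u <= 1 by rewrite ltW.
have /andP[y0 _] := cdf_inv_range M i u01; rewrite lt_neqAle y0 andbT.
apply/eqP => E; have := cdf_invK M i u01; rewrite -E genF0 => u_0.
by rewrite -u_0 ltxx in u0.
Qed.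

Lemma cdf_inv_le i u x : 0 <= u <= 1 -> 0 <= x -> u <= genF M i x ->
  cdf_inv M i u <= x.
Proof.
move=> u01 x0 uF; rewrite leNgt; apply/negP => /(genF_lt x0) H.
have /andP[_ /H] := cdf_inv_range M i u01.
by rewrite cdf_invK// ltNge uF.
Qed.

Lemma penalty_gt0 : 0 < penalty M.
Proof. exact: lt_trans (price_cap_gt0 M) (price_cap_lt_penalty M). Qed.

(** Markov's inequality at the median [a]: generation exceeds [a > 0] with probability 1/2, so the
    mean is at least [a / 2]. *)
Lemma mean_gen_gt0 i : 0 < mean_gen M i.
Proof.
have h01 : 0 <= (2^-1 : R) <= 1 by apply/andP; split; lra.
set a := cdf_inv M i 2^-1.
have a0 : 0 < a by apply: cdf_inv_gt0; lra.
have Fa : genF M i a = 2^-1 by exact: cdf_invK.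
pose A := gen M i @^-1` `]-oo, a].
have mA : measurable A.
  by rewrite -[A]setTI; exact: measurable_funP.
have PA : Pr M (~` A) = (2^-1)%:E.
  by rewrite probability_setC// -genFE Fa -EFinB; congr EFin; lra.
have le_mean : ((a * 2^-1)%:E <= 'E_(Pr M)[gen M i])%E.
  rewrite EFinM -PA -(setIT (~` A)) -integral_indic//; last exact: measurableC.
  rewrite -ge0_integralZl//=; try by [rewrite lee_fin ltW
    | exact/measurable_EFinP/measurable_indic/measurableC
    | move=> w _; rewrite lee_fin].
  rewrite unlock; apply: ge0_le_integral_nonmeasurable => w _;
    rewrite -EFinM lee_fin.
    by rewrite mulr_ge0// ltW.
  rewrite indicE; have /andP[X0 _] := gen_bounded M i w.
  case: (boolP (_ \in _)) => [|_]; last by rewrite mulr0.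
  by rewrite inE /A /= in_itv /= mulr1 => /negP; rewrite -ltNge => /ltW.
(* Finiteness matters: [mean_gen] takes [fine], which would turn an infinite mean into 0. *)
have : ('E_(Pr M)[gen M i] <= (capacity M i)%:E)%E.
  rewrite -[leRHS]mule1 -(probability_setT (Pr M)) -integral_cst//.
  rewrite unlock; apply: ge0_le_integral_nonmeasurable => w _; rewrite lee_fin;
    by have /andP[] := gen_bounded M i w.
move=> /le_lt_trans /(_ (ltry _)) mean_fin.
rewrite /mean_gen -lte_fin fineK.
  by apply: lt_le_trans le_mean; rewrite lte_fin mulr_gt0.
rewrite ge0_fin_numE//; apply: expectation_ge0 => w.
by have /andP[] := gen_bounded M i w.
Qed.

End generation.

(** * Revenue of one supplier as a function of his price and the quantity sold *)

Section price_competition.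
Context d (T : measurableType d) (R : realType) (M : market T R).
Variable phi : bool -> bool.
Implicit Types (i j k : bool) (x q c : R) (p : bool -> R).
Implicit Types mu : bool -> probability (measurableTypeR R) R.

(** A bid depends only on the bidder's own price, so a constant profile represents every [p] with
    [p i = q]. *)
Local Notation quantity i q := (bid_quantity M phi (fun=> q) i).

Lemma pricesE q : prices M q <-> 0 <= q <= price_cap M.
Proof. by rewrite /prices /= in_itv. Qed.

Lemma price_penalty01 q : prices M q -> 0 <= q / penalty M <= 1.
Proof.
have l0 := penalty_gt0 M; move=> /pricesE/andP[q0 qc].
rewrite divr_ge0 ?(ltW l0)//= ler_pdivrMr// mul1r.
exact/ltW/(le_lt_trans qc)/price_cap_lt_penalty.
Qed.

Lemma quantity_ge0 i q : prices M q -> 0 <= quantity i q.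
Proof.
move=> /price_penalty01 h; rewrite /bid_quantity; case: ifP => _.
  exact/ltW/mean_gen_gt0.
by have /andP[] := cdf_inv_range M i h.
Qed.

Lemma quantity_gt0 i q : prices M q -> 0 < q -> 0 < quantity i q.
Proof.
move=> /price_penalty01/andP[_ q1] q0; rewrite /bid_quantity.
case: ifP => _; first exact: mean_gen_gt0.
by rewrite cdf_inv_gt0// divr_gt0// penalty_gt0.
Qed.

Lemma supplier_revenue_le i q x : supplier_revenue M phi i q x <= q * x.
Proof.
have l0 := ltW (penalty_gt0 M).
rewrite /supplier_revenue; case: ifP => _; rewrite gerBl mulr_ge0//.
  by rewrite le_max lexx orbT.
by apply/fine_ge0/expectation_ge0 => w; rewrite le_max lexx orbT.
Qed.

Lemma storage_revenueE i q x : phi i -> x <= quantity i q ->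
  supplier_revenue M phi i q x = q * x.
Proof.
rewrite /bid_quantity /supplier_revenue => -> xm.
by rewrite max_r ?subr_le0// mulr0 subr0.
Qed.

(** Since [x] is at most the bid [F^-1(q / lambda)], one has [lambda F(x) <= q]. In [excess_le], the
    penalty on the part [x - z] is then covered by its sales [q (x - z)], and only the first [z]
    units remain in the bound. *)
Lemma no_storage_revenue_ge i q x z : ~~ phi i -> prices M q ->
  0 <= z <= x -> x <= quantity i q ->
  z * (q - penalty M * genF M i z) <= supplier_revenue M phi i q x.
Proof.
rewrite /bid_quantity /supplier_revenue => /negbTE -> hq zx xy.
have l0 := penalty_gt0 M; have h01 := price_penalty01 hq.
have /andP[z0 z_le] := zx.
have Fx : genF M i x * penalty M <= q.
  by rewrite -ler_pdivlMr// -(cdf_invK M i h01) genF_le.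
have := excess_le M i zx; set e := fine _ => he.
have : penalty M * e <=
    penalty M * ((x - z) * genF M i x + z * genF M i z) by rewrite ler_pM2l.
nra.
Qed.

Lemma supplier_revenue_ge0 i q x : prices M q -> 0 <= x <= quantity i q ->
  0 <= supplier_revenue M phi i q x.
Proof.
move=> hq /andP[x0 xy]; have [s|ns] := boolP (phi i).
  by rewrite storage_revenueE// mulr_ge0//; have /pricesE/andP[] := hq.
have := @no_storage_revenue_ge i q x 0 ns hq.
by rewrite mul0r; apply; rewrite ?lexx.
Qed.

(** With storage, [a = q]. Without it, the previous bound is taken at [z = x / 2]: the margin
    [q - lambda F(x / 2)] is at least its value at [x = y], which is positive because
    [F(y / 2) < F(y) = q / lambda]. *)
Lemma supplier_revenue_ge_linear i q : prices M q -> 0 < q ->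
  exists2 a, 0 < a &
    forall x, 0 <= x <= quantity i q -> a * x <= supplier_revenue M phi i q x.
Proof.
move=> hq q0; have [s|ns] := boolP (phi i).
  by exists q => // x /andP[_ xy]; rewrite storage_revenueE.
have l0 := penalty_gt0 M.
have y0 := quantity_gt0 i hq q0; set y := quantity i q in y0 *.
have yE : y = cdf_inv M i (q / penalty M).
  by rewrite /y /bid_quantity (negbTE ns).
have h01 := price_penalty01 hq.
have Fy : genF M i (y / 2) < q / penalty M.
  rewrite -(cdf_invK M i h01) -yE; apply: genF_lt; [lra|lra|].
  by rewrite yE; have /andP[] := cdf_inv_range M i h01.
rewrite ltr_pdivlMr// mulrC in Fy.
exists ((q - penalty M * genF M i (y / 2)) / 2); first lra.
move=> x /andP[x0 xy].
have x2 : 0 <= x / 2 <= x by apply/andP; split; lra.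
apply: le_trans (no_storage_revenue_ge ns hq x2 xy).
have : genF M i (x / 2) <= genF M i (y / 2) by apply: genF_le; lra.
move=> /(ler_wpM2l (ltW l0)) Fxy; rewrite mulrAC -mulrA mulrC.
by rewrite ler_wpM2l ?lerB//; case/andP: x2.
Qed.

(** * Allocation, order of service and guaranteed revenues *)

Lemma alloc_bounds (y : bool -> R) k i :
  (forall j, 0 <= y j) -> 0 <= alloc (demand M) y k i <= y i.
Proof.
move=> y0; have D0 := demand_gt0 M.
rewrite /alloc; case: eqP => [->|_].
  by rewrite le_min (ltW D0) y0 ge_min lexx orbT.
by rewrite le_min subr_ge0 ge_min lexx y0 ge_min lexx orbT.
Qed.

Lemma alloc_le_demand (y : bool -> R) k i :
  (forall j, 0 <= y j) -> alloc (demand M) y k i <= demand M.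
Proof.
move=> y0; have D0 := demand_gt0 M.
rewrite /alloc; case: eqP => [_|_]; first by rewrite ge_min lexx.
by rewrite ge_min gerBl le_min (ltW D0) y0.
Qed.

Lemma first_prob_ge0 p k : 0 <= first_prob M phi p k.
Proof. by rewrite /first_prob; do ![case: ifP => _ //]; rewrite invr_ge0. Qed.

Lemma first_prob_sum p : \sum_(k : bool) first_prob M phi p k = 1.
Proof.
rewrite big_bool /first_prob /=.
case: (ltgtP (p true) (p false)) => _ /=; rewrite ?addr0 ?add0r//.
case: ltgtP => _ /=; rewrite ?addr0 ?add0r//; lra.
Qed.

Lemma first_prob_eq0 p k : p (~~ k) < p k -> first_prob M phi p k = 0.
Proof. by move=> h; rewrite /first_prob ltNge (ltW h) /= h. Qed.

(** Revenue is an average over the orders of service, and an order serving the strictly dearer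
    supplier first has weight 0. At equal prices the bound is required for both orders. *)
Lemma revenue_ge p i c :
  (forall k, p k <= p (~~ k) -> c <= revenue_first M phi p k i) ->
  c <= revenue M phi p i.
Proof.
move=> h; rewrite -[c]mul1r -(first_prob_sum p) mulr_suml.
apply: ler_sum => k _; have [/first_prob_eq0->|pk] := ltP (p (~~ k)) (p k).
  by rewrite !mul0r.
by rewrite ler_wpM2l ?first_prob_ge0 ?h.
Qed.

Lemma revenue_ge0 p i : (forall j, prices M (p j)) -> 0 <= revenue M phi p i.
Proof.
move=> hp; apply: revenue_ge => k _; apply: supplier_revenue_ge0 => //.
by apply: alloc_bounds => j; exact: quantity_ge0 (hp j).
Qed.

Lemma revenue_le p i : (forall j, prices M (p j)) ->
  revenue M phi p i <= p i * demand M.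
Proof.
move=> hp; rewrite -[leRHS]mul1r -(first_prob_sum p) mulr_suml.
apply: ler_sum => k _; rewrite ler_wpM2l ?first_prob_ge0//.
apply: le_trans (supplier_revenue_le _ _ _) _.
rewrite ler_wpM2l//; first by have /pricesE/andP[] := hp i.
by apply: alloc_le_demand => j; exact: quantity_ge0 (hp j).
Qed.

(** The constant [c] is chosen before [p], so the bound is uniform in the competitor's price and
    survives integration over it. *)
Lemma revenue_ge_of_alloc i q x : prices M q -> 0 < q -> 0 < x ->
  exists2 c, 0 < c & forall p, p i = q -> prices M (p (~~ i)) ->
    (forall k, p k <= p (~~ k) ->
      x <= alloc (demand M) (bid_quantity M phi p) k i) ->
    c <= revenue M phi p i.
Proof.
move=> hq q0 x0; have [a a0 ha] := supplier_revenue_ge_linear i hq q0.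
exists (a * x) => [|p piq hpj hx]; first exact: mulr_gt0.
apply: revenue_ge => k pk; rewrite /revenue_first piq.
have hp j : prices M (p j).
  by case: (eqVneq i j) => [<-|/neq_negb->]; rewrite ?piq.
apply: (@le_trans _ _ (a * alloc (demand M) (bid_quantity M phi p) k i)).
  by rewrite ler_pM2l// hx.
apply: ha; have := @alloc_bounds (bid_quantity M phi p) k i.
rewrite {2 3}/bid_quantity -piq; apply => j; exact: quantity_ge0 (hp j).
Qed.

Lemma secure_revenue i : ~~ phi (~~ i) ->
  exists q c, [/\ prices M q, 0 < c & forall p, p i = q ->
    prices M (p (~~ i)) -> c <= revenue M phi p i].
Proof.
move=> ns; have D0 := demand_gt0 M; have l0 := penalty_gt0 M.
have C0 : 0 < capacity M (~~ i).
  have h1 : 0 <= (1 : R) <= 1 by rewrite ler01 lexx.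
  have /andP[_] := cdf_inv_range M (~~ i) h1; apply: lt_le_trans.
  by rewrite cdf_inv_gt0.
(* At most half the demand, and in [(0, capacity]], where the CDF is positive. *)
pose t := Num.min (demand M / 2) (capacity M (~~ i)).
have t0 : 0 < t by rewrite lt_min C0 andbT divr_gt0.
have Ft : 0 < genF M (~~ i) t.
  by rewrite -(genF0 M (~~ i)) genF_lt// ge_min lexx orbT.
(* Chosen so that [q / lambda <= F(t)]: a competitor priced at most [q] then offers at most [t]. *)
pose q := Num.min (price_cap M) (genF M (~~ i) t * penalty M).
have q0 : 0 < q by rewrite lt_min price_cap_gt0 mulr_gt0.
have hq : prices M q by apply/pricesE; rewrite (ltW q0) ge_min lexx.
have y0 := quantity_gt0 i hq q0.
have x0 : 0 < Num.min (demand M / 2) (quantity i q).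
  by rewrite lt_min y0 divr_gt0.
have [c c0 hc] := revenue_ge_of_alloc i hq q0 x0.
exists q, c; split=> // p piq hpj; apply: hc => // k pk.
have yiE : bid_quantity M phi p i = quantity i q by rewrite /bid_quantity piq.
rewrite /alloc; case: eqVneq => [<-|/neq_negb kE].
  by rewrite yiE le_min !ge_min lexx orbT andbT; apply/orP; left; lra.
(* The competitor is served first, hence his price is at most [q], and at least [demand M / 2] is
   left over. *)
move: pk; rewrite {}kE negbK piq => pq.
have yj : bid_quantity M phi p (~~ i) <= demand M / 2.
  rewrite /bid_quantity (negbTE ns).
  apply: (@le_trans _ _ t); last by rewrite ge_min lexx.
  apply: cdf_inv_le; [exact: price_penalty01|exact: ltW|].
  by rewrite ler_pdivrMr// (le_trans pq)// ge_min lexx orbT.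
rewrite yiE le_min !ge_min lexx orbT andbT; apply/orP; left.
have : Num.min (demand M) (bid_quantity M phi p (~~ i)) <= demand M / 2.
  by rewrite ge_min yj orbT.
lra.
Qed.

Lemma undercut_revenue i q : prices M q -> 0 < q ->
  exists2 c, 0 < c & forall p, p i = q -> prices M (p (~~ i)) ->
    q < p (~~ i) -> c <= revenue M phi p i.
Proof.
move=> hq q0.
have x0 : 0 < Num.min (demand M) (quantity i q).
  by rewrite lt_min demand_gt0 quantity_gt0.
have [c c0 hc] := revenue_ge_of_alloc i hq q0 x0.
exists c => // p piq hpj qp; apply: hc => // k pk.
case: (eqVneq i k) => [<-|/neq_negb kE]; last first.
  by move: pk; rewrite kE negbK piq leNgt qp.
by rewrite /alloc eqxx /bid_quantity piq.
Qed.

(** * Bounds on expected revenue under mixed strategies *)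

Let profile (z : R * R) : bool -> R := fun j => if j then z.2 else z.1.

Lemma measurable_prices : measurable (prices M : set (measurableTypeR R)).
Proof. exact: measurable_itv. Qed.

(** Orders the factors as own and competitor's, whichever supplier [i] is. *)
Lemma product_rectangle mu i (B : bool -> set (measurableTypeR R)) :
  (forall j, measurable (B j)) ->
  (mu false \x mu true)%E (B false `*` B true)
  = (mu i (B i) * mu (~~ i) (B (~~ i)))%E.
Proof.
by move=> mB; rewrite product_measure1E//; case: i; rewrite //= muleC.
Qed.

Lemma profile_prices z : (prices M `*` prices M) z ->
  forall j, prices M (profile z j).
Proof. by case=> ? ? []. Qed.

(** The integrand is nonnegative and at least [c] on the rectangle of the [B j], so it dominates [c]
    times the indicator of that rectangle. *)
Lemma expected_revenue_ge mu i (B : bool -> set (measurableTypeR R)) c :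
  (forall j, measurable (B j)) -> (forall j, B j `<=` prices M) -> 0 <= c ->
  (forall p, (forall j, B j (p j)) -> c <= revenue M phi p i) ->
  (c%:E * (mu i (B i) * mu (~~ i) (B (~~ i))) <= expected_revenue M phi mu i)%E.
Proof.
move=> mB BM c0 hc; have mP := measurable_prices.
have mBB : measurable (B false `*` B true) by exact: measurableX.
have BBM : B false `*` B true `<=` prices M `*` prices M.
  by move=> z [z1 z2]; split; [exact: (BM _ _ z1)|exact: (BM _ _ z2)].
rewrite -product_rectangle// -(setIidl BBM) -integral_indic//;
  last exact: measurableX.
rewrite -ge0_integralZl//=; try by [exact: measurableX
  | exact/measurable_EFinP/measurable_indic | move=> z _; rewrite lee_fin].
apply: ge0_le_integral_nonmeasurable => z hz; rewrite -EFinM lee_fin.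
  by rewrite mulr_ge0.
rewrite indicE; case: (boolP (z \in _)) => [|_].
  by rewrite inE mulr1 => -[z1 z2]; apply: hc => -[].
by rewrite mulr0 revenue_ge0//; exact: (profile_prices hz).
Qed.

(** Revenue is at most own price times demand, hence at most [q * demand M] plus a constant times
    the indicator of own price above [q]; the latter event is null. *)
Lemma expected_revenue_le mu i q : (forall j, mixed_strategy M (mu j)) ->
  0 <= q -> mu i (prices M `&` [set x | q < x]) = 0%E ->
  (expected_revenue M phi mu i <= (q * demand M)%:E)%E.
Proof.
move=> hmu q0 mu0; have mP := measurable_prices.
have D0 := ltW (demand_gt0 M); have P0 := ltW (price_cap_gt0 M).
pose B j : set (measurableTypeR R) :=
  if j == i then prices M `&` [set x | q < x] else prices M.
have mB j : measurable (B j).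
  rewrite /B; case: ifP => // _; apply: measurableI => //.
  by rewrite -set_itvoy; exact: measurable_itv.
pose BB := B false `*` B true.
have mBB : measurable BB by exact: measurableX.
have mPP : measurable
    (prices M `*` prices M : set (measurableTypeR R * measurableTypeR R)).
  exact: measurableX.
apply: (@le_trans _ _ (\int[mu false \x mu true]_(z in prices M `*` prices M)
   ((q * demand M)%:E + (price_cap M * demand M)%:E * (\1_BB z)%:E))%E).
  apply: ge0_le_integral_nonmeasurable => z hz.
    by rewrite lee_fin revenue_ge0//; exact: (profile_prices hz).
  rewrite -EFinM -EFinD lee_fin.
  apply: le_trans (revenue_le _ (profile_prices hz)) _.
  rewrite mulrAC -mulrDl ler_wpM2r//.
  have hzi := profile_prices hz i; have /pricesE/andP[_ zc] := hzi.
  have [zq|qz] := leP (profile z i) q.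
    by rewrite (le_trans zq)// lerDl mulr_ge0.
  rewrite indicE mem_set ?mulr1 ?(le_trans zc) ?lerDr//.
  by case: hz => z1 z2; rewrite /BB /B; case: (i) qz => /= qz; split.
rewrite ge0_integralD//=; last 3 first.
- by move=> z _; rewrite lee_fin mulr_ge0.
- by move=> z _; rewrite -EFinM lee_fin !mulr_ge0.
- by apply: measurable_funeM; exact/measurable_EFinP/measurable_indic.
rewrite ge0_integralZl//=; try by [exact/measurable_EFinP/measurable_indic
  | move=> z _; rewrite lee_fin | rewrite lee_fin mulr_ge0].
have mass1 : (mu false \x mu true)%E (prices M `*` prices M) = 1%E.
  by rewrite product_measure1E// [X in (X * _)%E]hmu [X in (_ * X)%E]hmu mule1.
have mass0 : (mu false \x mu true)%E BB = 0%E.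
  by rewrite (product_rectangle _ i)// {1}/B eqxx mu0 mul0e.
rewrite integral_indic// integral_cst//.
rewrite [X in (_ * X + _)%E](_ : _ = 1%E); last exact: mass1.
rewrite [X in (_ + _ * X)%E](_ : _ = 0%E) ?mule1 ?mule0 ?adde0//.
by apply: (subset_measure0 _ mBB _ mass0) => //; exact: measurableI.
Qed.

End price_competition.

Theorem proposition5 (d : measure_display) (T : measurableType d)
    (R : realType) (M : market T R) (phi : bool -> bool)
    (hphi : (phi false + phi true <= 1)%N) (i : bool) :
  (forall p : bool -> R,
     pure_equilibrium M phi p -> 0 < revenue M phi p i) /\
  (forall mu : bool -> probability (measurableTypeR R) R,
     mixed_equilibrium M phi mu -> (0 < expected_revenue M phi mu i)%E).
Proof.
have D0 := demand_gt0 M.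
have devE S (s : bool -> S) j s' : deviate s j s' j = s'.
  by rewrite /deviate eqxx.
have devN S (s : bool -> S) j s' : deviate s j s' (~~ j) = s (~~ j).
  by rewrite /deviate; case: j.
(* At most one supplier stores, so a storing competitor faces a supplier without storage. *)
have storage_neg : phi (~~ i) -> ~~ phi (~~ ~~ i).
  by move: hphi; case: i; case: (phi false); case: (phi true).
split=> [p [hp eqp]|mu [hmu eqmu]].
  have secure j : ~~ phi (~~ j) -> 0 < revenue M phi p j.
    move=> /(secure_revenue M)[q [c [hq c0 hc]]].
    apply: lt_le_trans (eqp j q hq); apply: lt_le_trans c0 _.
    by apply: hc; rewrite ?devE ?devN.
  have [/storage_neg/secure rj|] := boolP (phi (~~ i)); last exact: secure.
  have pj0 : 0 < p (~~ i).
    by have := lt_le_trans rj (revenue_le phi (~~ i) hp); rewrite pmulr_lgt0.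
  have /pricesE/andP[_ pjc] := hp (~~ i).
  (* Half the competitor's positive price is still positive and strictly undercuts him. *)
  have hq : prices M (p (~~ i) / 2) by apply/pricesE/andP; split; lra.
  have [|c c0 hc] := undercut_revenue phi i hq; first lra.
  apply: lt_le_trans (eqp i _ hq); apply: lt_le_trans c0 _.
  by apply: hc; rewrite ?devE ?devN//; lra.
(* Equilibrium revenue is compared with the deviation to the point mass at [q], restricted to
   competitor prices in [A]. *)
have ge_dirac j q c (A : set (measurableTypeR R)) : prices M q -> 0 <= c ->
    measurable A -> A `<=` prices M ->
    (forall p, p j = q -> A (p (~~ j)) -> c <= revenue M phi p j) ->
    (c%:E * mu (~~ j) A <= expected_revenue M phi mu j)%E.
  move=> hq c0 mA AP hc.
  pose nu : probability (measurableTypeR R) R := \d_(q : measurableTypeR R).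
  have hnu : mixed_strategy M nu.
    by rewrite /mixed_strategy /nu /= diracE mem_set.
  apply: le_trans (eqmu j nu hnu).
  pose B k : set (measurableTypeR R) := if k == j then [set q] else A.
  have BN : B (~~ j) = A by rewrite /B; case: (j).
  have BE : B j = [set q] by rewrite /B eqxx.
  have := @expected_revenue_ge _ _ _ M phi (deviate mu j nu) j B c.
  rewrite devE devN BE BN /nu /= diracE mem_set//= mul1e; apply => //.
  - by move=> k; rewrite /B; case: ifP.
  - by move=> k; rewrite /B; case: ifP => // _ _ ->.
  - move=> p Bp; apply: hc; last by rewrite -BN; exact: Bp.
    by have := Bp j; rewrite BE.
have secure j : ~~ phi (~~ j) ->
    exists2 c, 0 < c & (c%:E <= expected_revenue M phi mu j)%E.
  move=> /(secure_revenue M)[q [c [hq c0 hc]]]; exists c => //.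
  rewrite -[c%:E]mule1 -(hmu (~~ j)).
  by apply: (ge_dirac _ q) => //; [exact: ltW|exact: measurable_prices].
have [/storage_neg/secure[c c0 rj]|/secure[c c0 ri]] := boolP (phi (~~ i));
  last exact: lt_le_trans ri.
(* With this [q], a competitor almost surely bidding at most [q] would earn at most
   [q * demand M <= c / 2], contradicting his guaranteed [c]. *)
pose q := Num.min (price_cap M) (c / (2 * demand M)).
have q0 : 0 < q by rewrite lt_min price_cap_gt0 divr_gt0// mulr_gt0.
have hq : prices M q by apply/pricesE; rewrite (ltW q0) ge_min lexx.
pose A : set (measurableTypeR R) := prices M `&` [set x | q < x].
have mA : measurable A.
  apply: measurableI; first exact: measurable_prices.
  by rewrite -set_itvoy; exact: measurable_itv.
have muA0 : mu (~~ i) A != 0%E.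
  apply/eqP => /(expected_revenue_le phi hmu (ltW q0)) /(le_trans rj).
  rewrite lee_fin leNgt => /negP; apply.
  have : q <= c / (2 * demand M) by rewrite ge_min lexx orbT.
  rewrite ler_pdivlMr ?mulr_gt0//; lra.
have [e e0 he] := undercut_revenue phi i hq q0.
apply: (@lt_le_trans _ _ (e%:E * mu (~~ i) A)%E).
  by rewrite mule_gt0 ?lte_fin// lt0e muA0 measure_ge0.
apply: (ge_dirac _ q) => //; [exact: ltW|by move=> x []|].
by move=> p pq [? ?]; exact: he.
Qed.
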